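(* Assume the setting and Assumptions A1, A2, A3 described in the context. Let $n\ge 1$ and let $(\ell,k)$ be any pair of positive integers with $\ell\ge 2$ such that $n=\ell k+r$ with $r\in\{0,1,\dots,k-1\}$. Then for every $\nu>0$, \[ \mathbb P\left(\Big\|\frac1n\sum_{i=1}^n X_i\Big\|\ \ge\ 4A_1C_1\Phi_{\mathcal C}(k)+4\sqrt{\frac{B\big(\sigma^2+C_2\Phi_{\mathcal C}(k)\big)\nu}{\ell}}+\frac{4c\nu}{3\ell}\right)\le 2e^{-\nu}, \] where $B=A_1^2+A_2$.
   Context: Let $(\mathcal B,\|\cdot\|)$ be a separable real Banach space with dual $\mathcal B^\star$ (dual norm $\|\cdot\|_\star$, duality pairing $\langle\cdot,\cdot\rangle$). For $r>0$ let $B(r)$ and $B^\star(r)$ denote the closed balls of radius $r$ centered at $0$ in $\mathcal B$ and $\mathcal B^\star$. Fix $c>0$ and put $\mathcal X=B(c)$. Let $(X_i)_{i\ge1}$ be a stochastic process on a probability space $(\Omega,\mathcal F,\mathbb P)$ with values in $\mathcal X$ which is centered ($\mathbb E X_i=0$ for all $i$, Bochner expectation). Let $\mathcal M_i=\sigma(X_1,\dots,X_i)$. $\mathcal C$-mixing: let $\mathcal C$ be a closed subspace of the Banach space of bounded real-valued functions on $\mathcal X$ (with the supremum norm), let $C(\cdot)$ be a seminorm on $\mathcal C$, and $\mathcal C_1=\{f\in\mathcal C: C(f)\le 1\}$. For integers $k\ge1$ the $\mathcal C$-mixing coefficients are $\Phi_{\mathcal C}(k)=\sup\{\|\mathbb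 E[\varphi(X_{i+k})\mid\mathcal M_i]-\mathbb E[\varphi(X_{i+k})]\|_{L_\infty(\mathbb P)}:\ \varphi\in\mathcal C_1,\ i\ge1\}$. Gâteaux derivatives: for $f:\mathcal B\to\mathbb R$, $x\in\mathcal B$, $v\in\mathcal B$, $\delta_v f(x)=\frac{d}{dt}\big|_{t=0}f(x+tv)$ when it exists; $\delta_{v,v}f(x)=\frac{d^2}{dt^2}\big|_{t=0}f(x+tv)$ denotes the second Gâteaux differential in direction $v$. Assumption A1: the norm $x\mapsto\|x\|$ is twice Gâteaux differentiable at every nonzero $x$ in all directions, and there are constants $A_1\ge1$, $A_2>0$ with $|\delta_v(\|x\|)|\le A_1\|v\|$ and $|\delta_{v,v}(\|x\|)|\le A_2\|v\|^2/\|x\|$ for all $x,v\in\mathcal B$, $x\ne0$. Assumption A2: there are constants $c,\sigma^2>0$ with $\|X_i\|\le c$ a.s. and $\mathbb E\|X_i\|^2\le\sigma^2$ for all $i$. Assumption A3: for each $s\in\mathcal B^\star$ the function $h_{1,s}(x)=\langle s,x\rangle$ (restricted to $\mathcal X$) belongs to $\mathcal C$, the function $h_2(x)=\|x\|^2$ belongs to $\mathcal C$, and $\sup_{s\in B^\star(1)}C(h_{1,s})\le C_1$, $C(h_2)\le C_2$ for constants $C_1,C_2\ge0$ (with $C_1>0$). *)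

(* Defs.v *)
From HB Require Import structures.
From mathcomp Require Import all_boot all_order all_algebra.
From mathcomp Require Import all_classical all_reals all_analysis.
From mathcomp Require Import ess_sup_inf.
Set Implicit Arguments. Unset Strict Implicit. Unset Printing Implicit Defensive.
Import Order.TTheory GRing.Theory Num.Theory.
Import numFieldNormedType.Exports.
Local Open Scope classical_set_scope.
Local Open Scope ring_scope.

Section defs.
Context {R : realType} {V : normedModType R}.

Definition borelV : set (set V) := <<s [set O : set V | open O] >>.

Definition separable_space : Prop := exists D : set V, countable D /\ dense D.

Definition is_dual (s : V -> R) : Prop :=
  (forall (a : R) (x y : V), s (a *: x + y) = a * s x + s y) /\ continuous s.

Definition in_dual_ball1 (s : V -> R) : Prop :=
  is_dual s /\ forall x : V, `|s x| <= `|x|.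

Definition ballc (c : R) : set V := [set x | `|x| <= c].

Definition assumption_A1 (A1 A2 : R) : Prop :=
  1 <= A1 /\ 0 < A2 /\
  forall x v : V, x != 0 ->
    let g := fun t : R => `|x + t *: v| in
    [/\ derivable g 0 1, derivable (derive1 g) 0 1,
        `|derive1 g 0| <= A1 * `|v| &
        `|derive1 (derive1 g) 0| <= A2 * `|v| ^+ 2 / `|x| ].

(** C : a closed linear subspace of the bounded real functions on B(c) (with
    the sup norm over B(c)), together with a seminorm Cn on C.  Functions on
    B(c) are represented by functions V -> R, only their values on B(c)
    matter.  Elements of C are also required to be Borel measurable on B(c)
    (needed for the conditional expectations in the mixing coefficients). *)
Definition function_class (c : R) (C : set (V -> R)) (Cn : (V -> R) -> R) : Prop :=
  [/\
      C (fun _ => 0) /\ (forall f g, C f -> C g -> C (fun x => f x + g x)) /\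
      (forall (a : R) f, C f -> C (fun x => a * f x)),
      (forall f, C f -> exists M : R, forall x, ballc c x -> `|f x| <= M),
      (forall (fn : nat -> V -> R) (f : V -> R), (forall n, C (fn n)) ->
         (exists M : R, forall x, ballc c x -> `|f x| <= M) ->
         (forall eps : R, 0 < eps -> exists N : nat, forall n, (N <= n)%N ->
             forall x, ballc c x -> `|fn n x - f x| <= eps) ->
         C f),
      (forall f, C f -> 0 <= Cn f) /\
      (forall (a : R) f, C f -> Cn (fun x => a * f x) = `|a| * Cn f) /\
      (forall f g, C f -> C g -> Cn (fun x => f x + g x) <= Cn f + Cn g) /\
      (forall f g, C f -> C g -> (forall x, ballc c x -> f x = g x) ->
              Cn f = Cn g) &
      (forall f, C f -> forall B : set R, measurable B ->
          borelV (ballc c `&` f @^-1` B))].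

Definition assumption_A3 (C : set (V -> R)) (Cn : (V -> R) -> R) (C1 C2 : R) : Prop :=
  [/\ 0 < C1 /\ 0 <= C2,
      (forall s, is_dual s -> C s),
      C (fun x => `|x| ^+ 2),
      (forall s, in_dual_ball1 s -> Cn s <= C1) &
      Cn (fun x => `|x| ^+ 2) <= C2].
End defs.

Section proba.
Context {R : realType} {V : normedModType R} {d : measure_display}
  {T : measurableType d}.

Definition measurableV (Y : T -> V) : Prop :=
  forall B, borelV B -> measurable (Y @^-1` B).

Definition natural_filtration (X : nat -> T -> V) (i : nat) : set (set T) :=
  <<s [set A | exists j B, [/\ (1 <= j <= i)%N, borelV B & A = X j @^-1` B]] >>.

Definition cond_exp_version (P : probability T R) (G : set (set T))
    (Y g : T -> R) : Prop :=
  [/\ (forall B : set R, measurable B -> G (g @^-1` B)),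
      P.-integrable setT (EFin \o g) &
      forall A, G A ->
        (\int[P]_(w in A) (g w)%:E = \int[P]_(w in A) (Y w)%:E)%E].

Definition C_mixing_coef (P : probability T R) (X : nat -> T -> V)
    (C : set (V -> R)) (Cn : (V -> R) -> R) (k : nat) : \bar R :=
  ereal_sup [set e | exists (phi : V -> R) (i : nat) (g : T -> R),
     [/\ C phi, Cn phi <= 1, (1 <= i)%N,
         cond_exp_version P (natural_filtration X i) (phi \o X (i + k)%N) g &
         e = ess_sup P (fun w => (`|g w - fine (\int[P]_x (phi (X (i + k)%N x))%:E)|)%:E)]].

(** Centered process: E X_i = 0 (Bochner), expressed through the dual. *)
Definition centered (P : probability T R) (X : nat -> T -> V) : Prop :=
  forall i s, is_dual s -> (\int[P]_w (s (X i w))%:E = 0)%E.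

Definition assumption_A2 (P : probability T R) (X : nat -> T -> V) (c sigma2 : R) : Prop :=
  [/\ 0 < c, 0 < sigma2,
      (forall i, \forall w \ae P, `|X i w| <= c) &
      forall i, (\int[P]_w (`|X i w| ^+ 2)%:E <= sigma2%:E)%E].
End proba.

(* Main.v *)
(**
Split the [n] summands into [k] blocks of indices congruent mod [k]. Within a
block consecutive terms are [k] apart, so mixing says that the next term [X],
given the past [S], behaves like a centered variable up to [Phi].

For one block, consider [coshR (th * `|S|)]. Assumption A1 bounds the second
derivative of [t |-> coshR (th * `|S + t X|)] by
[th^2 (A1^2 + A2) `|X|^2] times the function itself, and the first derivative at
[0] is [th * sinhR (th * `|S|)] times a linear functional of [X] of norm at most
[A1]. A second order Taylor expansion, together with mixing applied to that
functional and to [`|x|^2], shows that adding one term multiplies the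
expectation by at most [growth_factor]. The functional depends on [S], so
[S] is first replaced by a point of a dense sequence on each piece of a
countable partition belonging to the past; only indicators of past events
ever have to be tested against the mixing coefficient.

Convexity of [exp] recombines the blocks, and Markov's inequality with a suitable
[th <= 1 / c] concludes.
*)

Require Import Defs.
From HB Require Import structures.
From mathcomp Require Import all_boot all_order all_algebra.
From mathcomp Require Import all_classical all_reals all_analysis.
From mathcomp Require Import measurable_realfun ess_sup_inf ring lra.
Import Order.TTheory GRing.Theory Num.Theory.
Import numFieldNormedType.Exports.
Local Open Scope classical_set_scope.
Local Open Scope ring_scope.

Set Implicit Arguments.
Unset Strict Implicit.
Unset Printing Implicit Defensive.

(** * Conditional expectations *)

(** The charge with density [Y], pushed forward by [phi], is dominated by the law of [phi]; [g] is
    its Radon-Nikodym derivative. *)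
Lemma cond_exp_factor_exists (R : realType) (d d' : measure_display)
    (T : measurableType d) (T' : measurableType d') (P : probability T R)
    (phi : {mfun T >-> T'}) (Y : T -> R) :
  P.-integrable setT (EFin \o Y) ->
  exists g : T' -> R, [/\ measurable_fun setT g,
    P.-integrable setT (EFin \o (g \o phi)) &
    forall A, measurable A -> (\int[P]_(w in phi @^-1` A) (g (phi w))%:E =
      \int[P]_(w in phi @^-1` A) (Y w)%:E)%E].
Proof.
move=> iY.
have mphi : measurable_fun setT phi by [].
have mpre A : measurable A -> measurable (phi @^-1` A).
  by move=> mA; rewrite -[X in measurable X]setTI; exact: mphi.
unshelve epose (nu := (pushforward (induced_charge iY) (phi : T -> T') :
  {charge set T' -> \bar R})).
  exact: mphi.
have numu : nu `<< (distribution P phi).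
  apply/null_content_dominatesP => A mA PA0.
  apply: null_set_integral => //; first exact: mpre.
  exact: measurable_funS (measurable_int _ iY).
pose g := Radon_Nikodym nu (distribution P phi).
have gfin w : g w \is a fin_num by exact: Radon_Nikodym_fin_num.
have ig : (distribution P phi).-integrable setT g.
  exact: Radon_Nikodym_integrable.
have mg : measurable_fun setT g := measurable_int _ ig.
have gE : EFin \o ((fine \o g) \o phi) = g \o phi.
  by apply/funext => w; rewrite /= fineK.
have igP : P.-integrable setT (g \o phi).
  apply/integrableP; split; first exact: measurableT_comp.
  have /integrableP[_] := ig.
  by rewrite ge0_integral_distribution//; exact: measurableT_comp.
exists (fine \o g); split => [||A mA].
- exact: measurableT_comp.
- by rewrite gE.
- rewrite -[RHS]/(nu A) (Radon_Nikodym_integral numu mA) -/g.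
  rewrite (integral_pushforward mphi mg)//.
  + by apply: eq_integral => w _; rewrite /= fineK.
  + by apply: integrableS igP => //; exact: mpre.
Qed.

(** Conditioning is the factorization above for the identity, seen as a map from [T] to [T] with the
    coarser sigma-algebra. *)
Lemma cond_exp_exists (R : realType) (d : measure_display)
    (T : measurableType d) (P : probability T R) (G : set (set T)) (Y : T -> R) :
  G `<=` measurable -> P.-integrable setT (EFin \o Y) ->
  exists g, cond_exp_version P <<s G >> Y g.
Proof.
move=> GT iY.
have mid : measurable_fun setT (idfun : T -> g_sigma_algebraType G).
  move=> _ B mB; rewrite setTI; apply: (smallest_sub _ GT) mB.
  exact: sigma_algebra_measurable.
pose idm : {mfun T >-> g_sigma_algebraType G} :=
  HB.pack (idfun : T -> g_sigma_algebraType G)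
    (isMeasurableFun.Build _ _ _ _ _ mid).
have [g [mg ig gE]] := cond_exp_factor_exists idm iY.
exists g; split => // B mB.
by move: (mg measurableT B mB); rewrite setTI.
Qed.

(** * Mixing *)

Section mixing.
Context {R : realType} {V : normedModType R} {d : measure_display}
  {T : measurableType d} (P : probability T R).

Lemma bounded_integrable (M : R) (f : T -> R) :
  measurable_fun setT f -> (forall w, `|f w| <= M) ->
  P.-integrable setT (EFin \o f).
Proof.
move=> mf fM; apply: measurable_bounded_integrable => //.
  by rewrite ltey_eq fin_num_measure.
by exists M; split; rewrite ?num_real// => x Mx w _; exact/(le_trans (fM w))/ltW.
Qed.

Lemma natural_filtration_measurable (X : nat -> T -> V) (i : nat) :
  (forall j, measurableV (X j)) -> natural_filtration X i `<=` measurable.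
Proof.
move=> mX; apply: smallest_sub; first exact: sigma_algebra_measurable.
by move=> _ [j [B [_ mB ->]]]; exact: mX.
Qed.

Lemma function_class_comp (c : R) (C : set (V -> R)) (Cn : (V -> R) -> R)
    (phi : V -> R) (Y : T -> V) :
  function_class c C Cn -> C phi -> measurableV Y ->
  (forall w, ballc c (Y w)) ->
  measurable_fun setT (phi \o Y) /\ P.-integrable setT (EFin \o (phi \o Y)).
Proof.
move=> [_ bC _ _ mC] Cphi mY cY.
have mphi : measurable_fun setT (phi \o Y).
  move=> _ B mB; rewrite setTI.
  have -> : (phi \o Y) @^-1` B = Y @^-1` (ballc c `&` phi @^-1` B).
    by apply/seteqP; split=> w /=; [move=> ?; split=> //; exact: cY|case].
  by apply: mY; exact: mC.
have [M hM] := bC _ Cphi.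
by split => //; apply: (@bounded_integrable M) => // w; exact/hM/cY.
Qed.

Variables (X : nat -> T -> V) (c : R) (C : set (V -> R)) (Cn : (V -> R) -> R).
Variables (k : nat) (Phi : R).
Hypotheses (mX : forall i, measurableV (X i)) (cX : forall i w, ballc c (X i w)).
Hypotheses (fC : function_class c C Cn) (PhiE : C_mixing_coef P X C Cn k = Phi%:E).

(** The supremum in [C_mixing_coef] runs over versions of conditional expectations, so one has to be
    exhibited; its almost sure bound is then integrated over the past event [A]. *)
Lemma mixing_bound_unit (phi : V -> R) (i : nat) (A : set T) :
  C phi -> Cn phi <= 1 -> (1 <= i)%N -> natural_filtration X i A ->
  `|\int[P]_(w in A) phi (X (i + k) w)
    - (\int[P]_w phi (X (i + k) w)) * fine (P A)| <= Phi * fine (P A).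
Proof.
move=> Cphi phi1 i1 FA.
set Y := phi \o X (i + k)%N; set m := (\int[P]_w _)%R.
have mA := natural_filtration_measurable mX FA.
have [mYT iY] := function_class_comp fC Cphi (mX (i + k)) (cX (i + k)).
have [g gY] : exists g, cond_exp_version P (natural_filtration X i) Y g.
  apply: cond_exp_exists => // _ [j [B [_ mB ->]]]; exact: mX.
have [_ ig gE] := gY.
have mg : measurable_fun setT g by apply/measurable_EFinP; exact: measurable_int ig.
have gPhi : (ess_sup P (fun w => (`|g w - m|)%:E) <= Phi%:E)%E.
  rewrite -PhiE; apply: ereal_sup_ubound; exists phi, i, g; split => //.
have /ess_supP gae := gPhi.
have Phi0 : 0 <= Phi.
  rewrite -lee_fin; apply: le_trans gPhi; apply: ess_sup_gee.
    by rewrite [ltRHS](@probability_setT _ _ _ P).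
  by apply: nearW => w; rewrite lee_fin.
have iA (f : T -> R) : P.-integrable setT (EFin \o f) -> P.-integrable A (EFin \o f).
  by move=> /integrableS; apply.
have icst : P.-integrable A (EFin \o cst m) by exact: finite_measure_integrable_cst.
have -> : \int[P]_(w in A) phi (X (i + k) w) - m * fine (P A) =
    \int[P]_(w in A) (g w - m).
  rewrite RintegralB//; [|exact: iA..].
  by rewrite Rintegral_cst// /Rintegral gE.
have iB : P.-integrable A (EFin \o (fun w => g w - m)).
  by have := integrableB mA (iA _ ig) icst.
apply: (le_trans (le_normr_Rintegral mA iB)).
rewrite -lee_fin fineK ?integrable_fin_num//; last exact: integrable_norm.
rewrite EFinM fineK ?fin_num_measure//.
apply: (@integral_le_bound _ _ _ P A (fun w => (g w - m)%:E) Phi%:E) => //.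
  exact: measurable_int iB.
by apply: filterS gae => w + _.
Qed.
(** Testing the zero function on the whole space bounds an absolute value by [Phi]. *)
Lemma mixing_coef_ge0 : 0 <= Phi.
Proof.
have [[C0 [_ CZ]] _ _ [_ [CnZ _]] _] := fC.
have Cn0 : Cn (fun=> 0) = 0.
  by have := CnZ 0 _ C0; rewrite normr0 !mul0r.
have := @mixing_bound_unit (fun=> 0) 1 setT C0.
rewrite Cn0 ler01 [P _]probability_setT !mulr1 => /(_ isT isT) h.
apply: le_trans (normr_ge0 _) (h _).
by rewrite -setC0; apply: sigma_algebraC; exact: sigma_algebra0.
Qed.

Lemma mixing_bound (phi : V -> R) (K : R) (i : nat) (A : set T) :
  C phi -> 0 <= K -> Cn phi <= K -> (1 <= i)%N -> natural_filtration X i A ->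
  \int[P]_(w in A) phi (X (i + k) w)
    <= (\int[P]_w phi (X (i + k) w) + K * Phi) * fine (P A).
Proof.
move=> Cphi K0 phiK i1 FA.
have mA := natural_filtration_measurable mX FA.
have [_ iY] := function_class_comp fC Cphi (mX (i + k)) (cX (i + k)).
have [[_ [_ CZ]] _ _ [_ [CnZ _]] _] := fC.
have PhiPA : 0 <= Phi * fine (P A) by rewrite mulr_ge0 ?mixing_coef_ge0 ?fine_ge0.
rewrite mulrDl -lerBlDl -mulrA; apply/ler_addgt0Pr => e e0.
(* [K] may be zero, so [phi] is divided by a slightly larger [L]; the excess of [L] over [K] costs
   at most [e] after multiplication by [Phi * fine (P A)]. *)
pose L := K + e / (Phi * fine (P A) + 1).
have L0 : 0 < L by rewrite ltr_wpDl// divr_gt0// ltr_wpDl.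
have := @mixing_bound_unit (fun x => L^-1 * phi x) i A (CZ _ _ Cphi).
rewrite CnZ// [`|L^-1|]gtr0_norm ?invr_gt0// ler_pdivrMl// mulr1.
rewrite (le_trans phiK) ?lerDl ?divr_ge0// ?addr_ge0// ?(ltW e0)// => /(_ isT i1 FA).
rewrite !RintegralZl//; last exact: (integrableS measurableT).
rewrite -mulrA -mulrBr normrM [`|L^-1|]gtr0_norm ?invr_gt0//. rewrite ler_pdivrMl//.
move=> /(le_trans (ler_norm _)) /le_trans; apply.
rewrite mulrDl lerD2l -mulrA ler_piMr ?(ltW e0)//.
by rewrite mulrC ler_pdivrMr ?ltr_wpDl// mul1r lerDl.
Qed.
End mixing.

(** * Real analysis *)

Section hyperbolic.
Context {R : realType}.
Implicit Types x y u : R.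

Definition coshR x := (expR x + expR (- x)) / 2.
Definition sinhR x := (expR x - expR (- x)) / 2.

Lemma cosh0 : coshR 0 = 1.
Proof. by rewrite /coshR oppr0 expR0; field. Qed.

Lemma sinh0 : sinhR 0 = 0.
Proof. by rewrite /sinhR oppr0 expR0; field. Qed.

Lemma cosh_gt0 x : 0 < coshR x.
Proof. by rewrite divr_gt0// addr_gt0// expR_gt0. Qed.

Lemma coshN x : coshR (- x) = coshR x.
Proof. by rewrite /coshR opprK addrC. Qed.

Lemma sinh_ge0 x : 0 <= x -> 0 <= sinhR x.
Proof. by move=> x0; rewrite divr_ge0// subr_ge0 ler_expR; lra. Qed.

Lemma sinh_le_cosh x : sinhR x <= coshR x.
Proof. by rewrite /sinhR /coshR; have := expR_gt0 (- x); lra. Qed.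

Lemma expR_le_cosh x : expR x <= 2 * coshR x.
Proof. by rewrite /coshR; have := expR_gt0 (- x); lra. Qed.

Lemma cosh_lipschitz x y u : `|x - y| <= u -> coshR x <= coshR y * expR u.
Proof.
rewrite ler_norml => /andP[xy1 xy2].
rewrite /coshR mulrAC ler_pM2r ?invr_gt0// mulrDl -!expRD.
by rewrite lerD// ler_expR; lra.
Qed.

Global Instance is_derive_cosh x : is_derive x 1 coshR (sinhR x).
Proof.
rewrite /coshR /sinhR.
apply: is_derive_eq; rewrite /GRing.scale /=; ring.
Qed.

Global Instance is_derive_sinh x : is_derive x 1 sinhR (coshR x).
Proof.
rewrite /coshR /sinhR.
apply: is_derive_eq; rewrite /GRing.scale /=; ring.
Qed.
End hyperbolic.

Section real_derivatives.
Context {R : realType}.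

Lemma MVT_is_derive (f f1 : R -> R) (a b : R) : a < b ->
  (forall t : R, is_derive t 1 f (f1 t)) ->
  exists2 t, t \in `]a, b[ & f b - f a = f1 t * (b - a).
Proof.
move=> ab df; apply: MVT => //.
apply: derivable_within_continuous => t _.
by have [] := df t.
Qed.

Lemma taylor2_le (f f1 f2 : R -> R) (M : R) :
  (forall t : R, is_derive t 1 f (f1 t)) -> (forall t : R, is_derive t 1 f1 (f2 t)) ->
  (forall t, 0 <= t <= 1 -> f2 t <= M) -> f 1 <= f 0 + f1 0 + M / 2.
Proof.
move=> df df1 f2M.
(* The claim is [h 1 <= h 0]. The mean value theorem for [h], then for [f1] on [[0, t]], writes
   [h 1 - h 0] as [(f2 s - M) * t]. *)
pose h (t : R) := f t - f1 0 * t - M / 2 * t ^+ 2.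
have dh (t : R) : is_derive t 1 h (f1 t - f1 0 - M * t).
  by apply: is_derive_eq; rewrite /GRing.scale /=; field.
have [t /itvP t01 hE] := MVT_is_derive ltr01 dh.
have t0 : 0 < t by rewrite t01.
have [s /itvP s0t f1E] := MVT_is_derive t0 df1.
have : f2 s <= M by rewrite f2M// !(s0t, t01)//= (le_trans (y := t)) ?s0t ?t01.
have := t0; move: hE f1E; rewrite /h => hE f1E tpos f2sM.
have : f2 s * t <= M * t by rewrite ler_wpM2r// ltW.
by lra.
Qed.

Lemma sinh_le_mul_cosh (u : R) : 0 <= u -> sinhR u <= u * coshR u.
Proof.
rewrite le_eqVlt => /predU1P[<-|u0]; first by rewrite sinh0 mul0r.
(* [h] vanishes at [0] and its derivative is nonpositive on [t >= 0]. *)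
pose h (t : R) := sinhR t - t * coshR t.
have dh (t : R) : is_derive t 1 h (- (t * sinhR t)).
  by apply: is_derive_eq; rewrite /GRing.scale /=; ring.
have [t /itvP t0u] := MVT_is_derive u0 dh.
rewrite /h sinh0 mul0r !subr0 => hE.
have t_ge0 : 0 <= t by rewrite t0u.
by rewrite -subr_le0 hE mulNr oppr_le0 mulr_ge0 ?(ltW u0)// mulr_ge0// sinh_ge0.
Qed.

Lemma derive1_shift (f : R -> R) (t : R) :
  derive1 (fun s => f (t + s)) = (fun s => derive1 f (t + s)).
Proof.
apply/funext => s; rewrite /derive1.
suff -> : (fun h : R => h^-1 *: (f (t + (h + s)) - f (t + s))) =
  (fun h : R => h^-1 *: (f (h + (t + s)) - f (t + s))) by [].
by apply/funext => h; rewrite addrCA.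
Qed.

(** Assumption A1 gives derivatives at parameter [0] from a varying base point; this turns them into
    derivatives at any [t] along a fixed line. *)
Lemma is_derive_unshift (f : R -> R) (t : R) :
  derivable (fun s => f (t + s)) 0 1 -> is_derive t 1 f (derive1 f t).
Proof.
move=> df; apply: DeriveDef; last by rewrite derive1E.
have <- : (fun s => f (t + s)) \o (fun u => u - t) = f.
  by apply/funext => u /=; rewrite addrC subrK.
apply/derivable1_diffP/differentiable_comp; first exact/derivable1_diffP.
by apply/derivable1_diffP; rewrite subrr.
Qed.
End real_derivatives.

(** * Splitting into residue classes, recombining them, choosing the parameter *)

Lemma sum_residues (V : zmodType) (F : nat -> V) (l k r : nat) : (r < k)%N ->
  \sum_(1 <= i < (l * k + r).+1) F i =
  \sum_(b < k) \sum_(j < l + (b < r)) F (b.+1 + j * k)%N.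
Proof.
move=> rk.
(* The first [l * k] terms fill all blocks evenly; the [r] remaining ones lengthen the blocks
   [b < r] by one. *)
have full : \sum_(0 <= i < l * k) F i.+1 = \sum_(b < k) \sum_(j < l) F (b.+1 + j * k)%N.
  elim: l => [|l IHl].
    by rewrite mul0n big_geq// big1// => b _; rewrite big_ord0.
  under [RHS]eq_bigr do rewrite big_ord_recr /=.
  rewrite big_split/= -IHl mulSn addnC (big_cat_nat (n := (l * k)%N))//= ?leq_addr//.
  congr (_ + _); rewrite -{1}[(l * k)%N]add0n big_addn addKn big_mkord.
  by apply: eq_bigr => b _; rewrite addSn.
transitivity (\sum_(b < k) (\sum_(j < l) F (b.+1 + j * k)%N
    + if (b < r)%N then F (b.+1 + l * k)%N else 0)); last first.
  apply: eq_bigr => b _; case: (b < r)%N; first by rewrite addn1 big_ord_recr.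
  by rewrite addn0 addr0.
rewrite big_split /= -full -big_mkcond /= -(big_ord_widen k (fun b => F (b.+1 + l * k)%N)) ?(ltnW rk)//.
rewrite big_add1 /= (big_cat_nat (n := (l * k)%N))//= ?leq_addr//.
congr (_ + _); rewrite -{1}[(l * k)%N]add0n big_addn addKn big_mkord.
by apply: eq_bigr => b _; rewrite addSn.
Qed.

(** Jensen's inequality from the tangent of [expR] at the mean [m]: the deviations [y b - m] sum to
    zero. *)
Lemma expR_mean_le (R : realType) (k : nat) (y : 'I_k -> R) : (0 < k)%N ->
  expR (k%:R^-1 * \sum_(b < k) y b) <= k%:R^-1 * \sum_(b < k) expR (y b).
Proof.
move=> k0; set m := k%:R^-1 * _.
have k0R : 0 < k%:R :> R by rewrite ltr0n.
have mE : \sum_(b < k) y b = k%:R * m by rewrite /m mulVKf// gt_eqF.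
rewrite -(ler_pM2l k0R) mulVKf ?gt_eqF//.
apply: (@le_trans _ _ (\sum_(b < k) expR m * (1 + (y b - m)))).
  rewrite -mulr_sumr !big_split /= sumr_const card_ord sumrN sumr_const card_ord.
  by rewrite mE -[m *+ k]mulr_natl subrr addr0 mulrC.
apply: ler_sum => b _.
have -> : expR (y b) = expR m * expR (y b - m) by rewrite -expRD addrC subrK.
by rewrite ler_wpM2l ?expR_ge0// expR_ge1Dx.
Qed.

(* The unconstrained optimum is [sqrt (nu / (L * v))]; the cap [1 / c] is
   responsible for the linear term in [nu]. *)
Lemma bernstein_parameter (R : realType) (L a v nu c : R) :
  2 <= L -> 0 <= a -> 0 < v -> 0 < nu -> 0 < c ->
  exists th : R, [/\ 0 <= th, th * c <= 1 &
    (L + 1) * (th * a + 2 * th ^+ 2 * v) + nu <=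
    th * L * (4 * a + 4 * Num.sqrt (v * nu / L) + 4 * c * nu / (3 * L))].
Proof.
move=> L2 a0 v0 nu0 c0; have L0 : 0 < L by exact: lt_le_trans L2.
have [L0' v0' nu0' c0'] : [/\ 0 <= L, 0 <= v, 0 <= nu & 0 <= c] by rewrite !ltW.
pose t := Num.sqrt (nu / (L * v)).
have t0 : 0 <= t by exact: sqrtr_ge0.
have nuE : nu = L * v * t ^+ 2.
  rewrite sqr_sqrtr; last by rewrite divr_ge0 ?mulr_ge0 ?ltW.
  by rewrite mulrC divfK// gt_eqF// mulr_gt0.
have sqrtE : Num.sqrt (v * nu / L) = v * t.
  have -> : v * nu / L = (v * t) ^+ 2 by rewrite nuE; field; exact: lt0r_neq0.
  by rewrite sqrtr_sqr ger0_norm// mulr_ge0// ltW.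
rewrite sqrtE.
(* [L >= 2] gives [L + 1 <= 3 / 2 * L]. *)
have key th : 0 <= th -> (L + 1) * (th * a + 2 * th ^+ 2 * v)
    <= 3 / 2 * (L * th * a) + 3 * (L * v * th ^+ 2).
  move=> th0.
  have h1 : 0 <= (L - 2) * (th * a) by rewrite mulr_ge0 ?subr_ge0 ?mulr_ge0.
  have h2 : 0 <= (L - 2) * (th ^+ 2 * v).
    by rewrite mulr_ge0 ?subr_ge0 ?mulr_ge0 ?sqr_ge0 ?(ltW v0).
  by lra.
have [tc|tc] := leP (t * c) 1.
  (* The quadratic cost [3 * (L * v * t ^+ 2)] plus [nu = L * v * t ^+ 2] is exactly the square root
     term, whence its factor 4. *)
  exists t; split=> //; apply: le_trans (lerD (key t t0) (lexx nu)) _.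
  have h1 : 0 <= L * t * a by rewrite !mulr_ge0.
  have h2 : 0 <= t * L * (4 * c * nu / (3 * L)).
    by rewrite !(mulr_ge0, invr_ge0).
  by rewrite mulrDr mulrDr {1}nuE; lra.
(* Capped case: the term linear in [nu] alone contributes [4 / 3 * nu], and [c^-1 <= t] lets the
   square root term absorb the quadratic cost. *)
have th0 : 0 <= c^-1 by rewrite invr_ge0 ltW.
exists c^-1; split=> //; first by rewrite mulVf// gt_eqF.
apply: le_trans (lerD (key _ th0) (lexx nu)) _.
have tht : c^-1 <= t by rewrite -[c^-1]mulr1 ler_pdivrMl// mulrC ltW.
have h1 : 0 <= L * c^-1 * a by rewrite !mulr_ge0.
have h2 : L * v * c^-1 ^+ 2 <= L * v * (c^-1 * t).
  by rewrite ler_wpM2l ?mulr_ge0// expr2 ler_wpM2l.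
have h2' : 0 <= L * v * c^-1 ^+ 2 by rewrite mulr_ge0 ?sqr_ge0// mulr_ge0.
have h3 : c^-1 * L * (4 * c * nu / (3 * L)) = 4 / 3 * nu.
  by field; rewrite !lt0r_neq0.
by rewrite mulrDr h3 mulrDr; lra.
Qed.

(** * Smoothness of the norm *)

Section norm_smoothness.
Context {R : realType} {V : normedModType R} (A1 A2 : R).
Hypothesis hA1 : assumption_A1 (V := V) A1 A2.

Lemma norm_line_derive (d x : V) (t : R) : let N u := `|d + u *: x| in
  d + t *: x != 0 ->
  [/\ is_derive t 1 N (derive1 N t),
      is_derive t 1 (derive1 N) (derive1 (derive1 N) t),
      `|derive1 N t| <= A1 * `|x| &
      `|derive1 (derive1 N) t| <= A2 * `|x| ^+ 2 / N t].
Proof.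
move=> N /(hA1.2.2 (d + t *: x) x) /=.
have -> : (fun u : R => `|d + t *: x + u *: x|) = (fun u => N (t + u)).
  by apply/funext => u; rewrite /N scalerDl addrA.
rewrite !derive1_shift addr0 => -[dN dN1 N1 N2].
split; [exact: is_derive_unshift dN|exact: is_derive_unshift dN1|exact: N1|exact: N2].
Qed.

(** Off the origin this is the chain rule; the division by the norm in A1 is compensated by
    [sinhR u <= u * coshR u]. *)
Lemma cosh_line_derive (lam : R) (d x : V) : 0 <= lam ->
  exists f1 f2 : R -> R, forall t : R,
    [/\ is_derive t 1 (fun u : R => coshR (lam * `|d + u *: x|)) (f1 t),
        is_derive t 1 f1 (f2 t) &
        f2 t <= (A1 ^+ 2 + A2) * (lam * `|x|) ^+ 2 * coshR (lam * `|d + t *: x|)].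
Proof.
move=> lam0; have [A11 [A20 _]] := hA1.
(* A1 says nothing at the origin. If the line meets it at [t0], evenness of [coshR] makes the
   composite [coshR (a * (t - t0))], which is smooth, and [1 <= A1 ^+ 2] gives the bound. *)
have [[t0 t0E]|no0] := pselect (exists t0 : R, d + t0 *: x = 0).
  pose a := lam * `|x|.
  have NE (t : R) : coshR (lam * `|d + t *: x|) = coshR (a * (t - t0)).
    have -> : d + t *: x = (t - t0) *: x.
      have /eqP := t0E; rewrite addr_eq0 => /eqP ->.
      by rewrite scalerBl addrC.
    rewrite normrZ mulrCA -/a [_ * a]mulrC.
    by case: (ger0P (t - t0)) => _; rewrite ?mulrN ?coshN.
  exists (fun t => a * sinhR (a * (t - t0))), (fun t => a ^+ 2 * coshR (a * (t - t0))).
  move=> t; under eq_fun do rewrite NE; rewrite NE; split.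
  - have h : is_derive t 1 (fun u : R => a * (u - t0)) a.
      by apply: is_derive_eq; rewrite /GRing.scale /=; ring.
    by apply: is_derive_eq; rewrite /GRing.scale /=; ring.
  - have h : is_derive t 1 (fun u : R => a * (u - t0)) a.
      by apply: is_derive_eq; rewrite /GRing.scale /=; ring.
    by apply: is_derive_eq; rewrite /GRing.scale /=; ring.
  - rewrite ler_wpM2r ?(ltW (cosh_gt0 _))// ler_peMl ?sqr_ge0//.
    by have : 1 <= A1 ^+ 2 by [rewrite expr_ge1// (le_trans ler01)]; lra.
pose N u := `|d + u *: x|.
have nz (t : R) : d + t *: x != 0 by apply/eqP => ?; apply: no0; exists t.
exists (fun t => lam * derive1 N t * sinhR (lam * N t)).
exists (fun t => lam * derive1 (derive1 N) t * sinhR (lam * N t)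
  + (lam * derive1 N t) ^+ 2 * coshR (lam * N t)) => t.
have [dN dN1 N1 N2] := norm_line_derive (nz t).
have Nt0 : 0 < N t by rewrite normr_gt0.
split.
- rewrite -/N; apply: is_derive_eq; rewrite /GRing.scale /=; ring.
- by apply: is_derive_eq; rewrite /GRing.scale /=; ring.
- rewrite -/(N t) mulrDl mulrDl addrC lerD//.
    rewrite ler_wpM2r ?(ltW (cosh_gt0 _))// -exprMn -[leLHS]real_normK ?num_real//.
    rewrite ler_sqr ?nnegrE ?mulr_ge0// ?(le_trans ler01)//.
    by rewrite normrM ger0_norm// mulrCA ler_wpM2l.
  have lN : 0 <= lam * N t by rewrite mulr_ge0// ltW.
  apply: (@le_trans _ _ (lam * (A2 * `|x| ^+ 2 / N t) * sinhR (lam * N t))).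
    by rewrite ler_wpM2r ?sinh_ge0// ler_wpM2l// (le_trans (ler_norm _)).
  apply: (@le_trans _ _ (lam * (A2 * `|x| ^+ 2 / N t) * (lam * N t * coshR (lam * N t)))).
    rewrite ler_wpM2l ?sinh_le_mul_cosh// mulr_ge0// divr_ge0 ?(ltW Nt0)//.
    by rewrite mulr_ge0 ?(ltW A20).
  by rewrite le_eqVlt; apply/orP; left; apply/eqP; field; exact: lt0r_neq0.
Qed.

(** The functional is the directional derivative of the norm divided by [A1]. The chain rule gives
    homogeneity, a minimum at [0] gives additivity, and the bound in A1 then gives continuity. *)
Lemma norm_deriv_dual (d : V) : d != 0 ->
  exists2 s : V -> R, in_dual_ball1 s &
    forall v : V, is_derive (0 : R) 1 (fun t : R => `|d + t *: v|) (A1 * s v).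
Proof.
move=> d0; have [A11 [A20 _]] := hA1.
have A10 : 0 < A1 by exact: lt_le_trans A11.
pose N v (t : R) := `|d + t *: v|.
have dN v : is_derive (0 : R) 1 (N v) (derive1 (N v) 0).
  by have [] := @norm_line_derive d v 0; rewrite ?scale0r ?addr0.
pose s v := A1^-1 * derive1 (N v) 0.
have sE v : A1 * s v = derive1 (N v) 0 by rewrite /s mulVKf// gt_eqF.
have sle v : `|s v| <= `|v|.
  rewrite /s normrM gtr0_norm ?invr_gt0// ler_pdivrMl//.
  by have [] := @norm_line_derive d v 0; rewrite ?scale0r ?addr0.
have sZ a v : s (a *: v) = a * s v.
  rewrite /s mulrCA; congr (_ * _).
  have h : is_derive (0 : R) 1 (fun t : R => a * t) a.
    by apply: is_derive_eq; rewrite /GRing.scale /=; ring.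
  have h' : is_derive (a * 0) 1 (N v) (derive1 (N v) 0) by rewrite mulr0.
  have NE : N (a *: v) = N v \o (fun t : R => a * t).
    by apply/funext => t; rewrite /N /= scalerA mulrC.
  have := @is_derive1_comp _ (N v) (fun t : R => a * t) _ _ _ h' h.
  by rewrite -NE => h2; rewrite [LHS]derive1E derive_val mulrC.
(* [N] is convex along lines, so the function below is minimal at [0]. *)
have sD v w : s (v + w) = s v + s w.
  pose h t := N (2 *: v) t + N (2 *: w) t - 2 * N (v + w) t.
  (* Small enough that [d + t *: z] avoids the origin for [t] in the interval and every direction
     [z] occurring in [h]. *)
  pose a := `|d| / (2 * `|v| + 2 * `|w| + 1).
  have den0 : 0 < 2 * `|v| + 2 * `|w| + 1 by rewrite ltr_wpDl// addr_ge0// mulr_ge0.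
  have a0 : 0 < a by rewrite divr_gt0// normr_gt0.
  have Ndrv (z : V) (t : R) : `|z| <= 2 * `|v| + 2 * `|w| -> t \in `](- a), a[ ->
      derivable (N z) t 1.
    move=> zle /itvP ta.
    suff dtz : d + t *: z != 0 by have [[]] := norm_line_derive dtz.
    apply/eqP => /eqP; rewrite addr_eq0 => /eqP /(congr1 Num.norm).
    rewrite normrN normrZ => dE.
    suff : `|t| * `|z| < `|d| by rewrite dE ltxx.
    have : `|t| < a by rewrite ltr_norml !ta.
    rewrite ltr_pdivlMr// => /(le_lt_trans _); apply.
    by rewrite ler_wpM2l// (le_trans zle)// lerDl.
  have hdrv (t : R) : t \in `](- a), a[ -> derivable h t 1.
    move=> ta; apply: derivableB; first apply: derivableD.
    - by apply: Ndrv => //; rewrite normrZ ger0_norm// lerDl mulr_ge0.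
    - by apply: Ndrv => //; rewrite normrZ ger0_norm// lerDr mulr_ge0.
    - apply: derivableM => //; apply: Ndrv => //.
      by rewrite (le_trans (ler_normD _ _))// lerD// ler_peMl// ler1n.
  have hmin (t : R) : t \in `](- a), a[ -> h 0 <= h t.
    move=> _; rewrite /h /N !scale0r !addr0.
    have -> : `|d| + `|d| - 2 * `|d| = 0 by ring.
    rewrite subr_ge0 -[X in X * _]ger0_norm// -normrZ.
    apply: le_trans (ler_normD _ _).
    rewrite !scalerDr !scalerA (mulrC t) [2 in X in X <= _]mulr2n.
    by rewrite scalerDl scale1r addrACA.
  have a0in : 0 \in `](- a), a[ by rewrite in_itv /= oppr_lt0 a0.
  have aa : - a <= a by rewrite (@le_trans _ _ 0)// ?oppr_le0 ltW.
  have h0' : is_derive (0 : R) 1 h (A1 * s (2 *: v) + A1 * s (2 *: w) - 2 * (A1 * s (v + w))).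
    rewrite !sE /h; have := dN (2 *: v); have := dN (2 *: w); have := dN (v + w).
    move: (N _) (N _) (N _) (derive1 _ _) (derive1 _ _) (derive1 _ _).
    move=> f1 f2 f3 l1 l2 l3 df1 df2 df3.
    by apply: is_derive_eq; rewrite /GRing.scale /=; ring.
  have h0 := derive1_at_min aa hdrv a0in hmin.
  have := @derive_val _ _ _ _ _ _ _ h0; rewrite (@derive_val _ _ _ _ _ _ _ h0') !sZ.
  move=> E; apply: (mulfI (lt0r_neq0 A10)); lra.
exists s => [|v]; last by rewrite sE; exact: dN.
split => //; split.
  by move=> a x y; rewrite sD sZ.
move=> x; apply/cvgrPdist_le => e e0; near=> y.
have <- : s (x - y) = s x - s y by rewrite sD -scaleN1r sZ mulN1r.
apply: le_trans (sle _) _; near: y; apply/nbhs_ballP; exists e => //= y.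
by rewrite -ball_normE /=; exact: ltW.
Unshelve. all: by end_near. Qed.

(** A crude bound suffices: halved by Taylor's formula, this 4 becomes the 2 in [cosh_norm_step]. *)
Lemma expR1_le4 : expR 1 <= 4 :> R.
Proof.
have h : expR (- (1 / 2)) >= 1 / 2 :> R.
  by have := expR_ge1Dx (- (1 / 2) : R); lra.
have e2 : expR (1 / 2) <= 2 :> R.
  rewrite -[1 / 2]opprK expRN invf_ple ?posrE ?expR_gt0//.
  by rewrite (le_trans _ h)// div1r.
have -> : expR 1 = expR (1 / 2) * expR (1 / 2) :> R.
  by rewrite -expRD; congr expR; field.
have -> : 4 = 2 * 2 :> R by ring.
by rewrite ler_pM ?expR_ge0.
Qed.

(** Taylor's formula along [t |-> d + t *: x]. The functional [s] depends on [d] but not on [x], so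
    that mixing can be applied to it as a function of the increment. *)
Lemma cosh_norm_step (lam c : R) (d : V) : 0 <= lam -> lam * c <= 1 ->
  exists2 s : V -> R, in_dual_ball1 s & forall x, `|x| <= c ->
    coshR (lam * `|d + x|) <=
      coshR (lam * `|d|) * (1 + 2 * (A1 ^+ 2 + A2) * lam ^+ 2 * `|x| ^+ 2)
      + lam * A1 * sinhR (lam * `|d|) * s x.
Proof.
move=> lam0 lamc; have [A11 [A20 _]] := hA1.
have B0 : 0 <= A1 ^+ 2 + A2 by rewrite addr_ge0 ?sqr_ge0 ?ltW.
suff [s s1 sE] : exists2 s : V -> R, in_dual_ball1 s &
    forall x, is_derive (0 : R) 1 (fun t : R => coshR (lam * `|d + t *: x|))
      (lam * A1 * sinhR (lam * `|d|) * s x).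
  exists s => // x xc.
  have [f1 [f2 H]] := cosh_line_derive d x lam0.
  (* For [t] in [[0, 1]] the norm moves by at most [c], so [coshR] grows by a factor of at most
     [expR 1]. *)
  pose M := 4 * (A1 ^+ 2 + A2) * (lam * `|x|) ^+ 2 * coshR (lam * `|d|).
  have := @taylor2_le _ _ f1 f2 M (fun t => let: And3 h _ _ := H t in h)
    (fun t => let: And3 _ h _ := H t in h).
  rewrite scale1r scale0r addr0 => /(_ _)/le_trans; apply.
    move=> t /andP[t0 t1]; have [_ _] := H t; move=> /le_trans; apply.
    have -> : M = (A1 ^+ 2 + A2) * (lam * `|x|) ^+ 2 * (coshR (lam * `|d|) * 4).
      by rewrite /M; ring.
    rewrite ler_wpM2l ?mulr_ge0 ?sqr_ge0//.
    rewrite (le_trans (@cosh_lipschitz _ _ (lam * `|d|) 1 _))//.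
      rewrite -mulrBr normrM ger0_norm// (le_trans _ lamc)// ler_wpM2l//.
      rewrite (le_trans (ler_dist_dist _ _))// addrC addKr normrZ ger0_norm//.
      by rewrite (le_trans _ xc)// ler_piMl.
    by rewrite ler_wpM2l ?expR1_le4// ltW// cosh_gt0.
  have -> : f1 0 = lam * A1 * sinhR (lam * `|d|) * s x.
    have [df1 _ _] := H 0.
    by rewrite -(@derive_val _ _ _ _ _ _ _ df1) (@derive_val _ _ _ _ _ _ _ (sE x)).
  by rewrite le_eqVlt; apply/orP; left; apply/eqP; rewrite /M; field.
(* At [d = 0] the first derivative vanishes, so the zero functional serves where A1 does not
   apply. *)
have [->|d0] := eqVneq d 0.
  exists (fun=> 0).
    split; last by move=> x; rewrite normr0.
    by split; [move=> *; rewrite mulr0 addr0|exact: cst_continuous].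
  move=> x; rewrite mulr0.
  have -> : (fun t : R => coshR (lam * `|0 + t *: x|)) = (fun t => coshR (lam * `|x| * t)).
    apply/funext => t; rewrite add0r normrZ mulrCA mulrC.
    by case: (ger0P t) => _; rewrite ?mulrN ?coshN.
  have h : is_derive (0 : R) 1 (fun u : R => lam * `|x| * u) (lam * `|x|).
    by apply: is_derive_eq; rewrite /GRing.scale /=; ring.
  apply: is_derive_eq; transitivity (sinhR (lam * `|x| * 0) * (lam * `|x|)) => //.
  by rewrite mulr0 sinh0 mul0r.
have [s s1 ds] := norm_deriv_dual d0.
exists s => // x; have dsx := ds x.
pose N (t : R) := `|d + t *: x|.
have N0 : `|d| = N 0 by rewrite /N scale0r addr0.
rewrite -[X in is_derive _ _ X _]/(fun t : R => coshR (lam * N t)).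
have -> : lam * A1 * sinhR (lam * `|d|) * s x = lam * sinhR (lam * N 0) * (A1 * s x).
  by rewrite -N0; ring.
move: (A1 * s x) dsx => l; rewrite -/N; clear N0 ds; clearbody N => dN.
by apply: is_derive_eq; rewrite /GRing.scale /=; ring.
Qed.
End norm_smoothness.

(** * Measurability of vector-valued sums *)

Section ball_measurability.
Context {R : realType} {V : normedModType R}.

Lemma dense_sequence : separable_space (V := V) ->
  exists D : nat -> V, forall (v : V) (e : R), 0 < e -> exists q, `|v - D q| < e.
Proof.
move=> [D [cD dD]].
have nbD (v : V) (e : R) : 0 < e -> exists2 x, D x & `|v - x| < e.
  move=> e0; have [|x [/= vx Dx]] := dD (ball v e) _ (ball_open v e).
    by exists v; exact: ballxx.
  by exists x => //; move: vx; rewrite -ball_normE.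
have /pfcard_geP[D0|[f]] := cD.
  by have [x] := nbD 0 1 ltr01; rewrite D0.
exists (f : nat -> V); move=> v e /(nbD v)[x Dx vx].
by have [q _ qx] := @surj _ _ _ _ f _ Dx; exists q; rewrite qx.
Qed.

(** Testing balls only is enough for measurable norms and for small pieces around dense points, and
    it survives sums in a separable space. [U] is left free so that it can be [T] with the
    sigma-algebra of the past. *)
Definition ball_measurable {d : measure_display} {U : measurableType d}
  (Y : U -> V) := forall v a, measurable [set w | `|Y w - v| < a].

Context {d : measure_display} {U : measurableType d}.
Implicit Types Y Z : U -> V.

Lemma ball_measurable_norm Y : ball_measurable Y ->
  measurable_fun setT (fun w => `|Y w|).
Proof.
move=> mY; apply: (measurability _ (RGenInftyO.measurableE R)) => //.
move=> _ [_ [x ->] <-]; rewrite setTI.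
have := mY 0 x; congr (measurable _); apply/seteqP.
by split=> w /=; rewrite subr0 in_itv.
Qed.

Lemma borel_ball_measurable Y : measurableV Y -> ball_measurable Y.
Proof.
move=> mY v a; apply: (mY [set x | `|x - v| < a]).
apply: sub_sigma_algebra => /=.
have [a0|a0] := ltP 0 a.
  have -> : [set x : V | `|x - v| < a] = ball v a; last exact: ball_open.
  by apply/seteqP; split=> x; rewrite -ball_normE /= distrC.
suff -> : [set x : V | `|x - v| < a] = set0 by exact: open0.
by apply/seteqP; split=> x //= /(le_lt_trans (normr_ge0 _)); rewrite ltNge a0.
Qed.

Lemma ball_measurableD Y Z : separable_space (V := V) ->
  ball_measurable Y -> ball_measurable Z -> ball_measurable (fun w => Y w + Z w).
Proof.
move=> /dense_sequence[D dD] mY mZ v a.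
have -> : [set w | `|Y w + Z w - v| < a] = \bigcup_q \bigcup_n
    ([set w | `|Y w - D q| < n.+1%:R^-1] `&`
     [set w | `|Z w - (v - D q)| < a - n.+1%:R^-1]).
  apply/seteqP; split=> [w /= YZv|w [q _] [n _] /= [Yq Zq]]; last first.
    have -> : Y w + Z w - v = (Y w - D q) + (Z w - (v - D q)).
      by rewrite opprB addrACA addKr.
    apply: (le_lt_trans (ler_normD _ _)); apply: (lt_le_trans (ltrD Yq Zq)).
    by rewrite addrC subrK.
  (* Half of the slack: one half pays for replacing [Y w] by [D q], the other for the reduced
     radius. *)
  pose e := (a - `|Y w + Z w - v|) / 2.
  have e0 : 0 < e by rewrite divr_gt0// subr_gt0.
  have [n ne] : exists n : nat, n.+1%:R^-1 < e.
    by have [n _ /(_ n (leqnn n))] := near_infty_natSinv_lt (PosNum e0); exists n.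
  have [q Yq] := dD (Y w) n.+1%:R^-1 ltac:(by rewrite invr_gt0).
  exists q => //; exists n => //; split=> //=.
  have -> : Z w - (v - D q) = (Y w + Z w - v) - (Y w - D q).
    rewrite [Y w + _]addrC !opprB -!addrA; congr (_ + _).
    by rewrite [RHS]addrC -!addrA addNr addr0 addrC.
  rewrite (le_lt_trans (ler_normB _ _))//.
  move: ne Yq; rewrite /e; move: `|_| `|Y w - _| (_^-1) => y z u.
  by move=> ? ?; lra.
by apply: bigcup_measurable => q _; apply: bigcup_measurable => n _; exact: measurableI.
Qed.

Lemma ball_measurable_sum (I : Type) (s : seq I) (Y : I -> U -> V) :
  separable_space (V := V) -> (forall i, ball_measurable (Y i)) ->
  ball_measurable (fun w => \sum_(i <- s) Y i w).
Proof.
move=> sepV mY; elim: s => [v a|i s IHs].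
  under eq_set do rewrite big_nil.
  have [h|h] := boolP (`|0 - v| < a).
    by rewrite (_ : [set _ | _] = setT)//; apply/seteqP; split.
  by rewrite (_ : [set _ | _] = set0)//; apply/seteqP; split => // w /=; rewrite (negbTE h).
move=> v a; under eq_set do rewrite big_cons.
by apply: ball_measurableD => //; exact: mY.
Qed.
End ball_measurability.

(** * Exponential moments of the blocks *)

Section martingale_step.
Context {R : realType} {V : normedModType R} {d : measure_display}
  {T : measurableType d} (P : probability T R).
Variables (X : nat -> T -> V) (c sigma2 A1 A2 C1 C2 : R)
  (C : set (V -> R)) (Cn : (V -> R) -> R) (k : nat) (Phi th : R).
Hypotheses (sepV : separable_space (V := V))
  (cX : forall i w, ballc c (X i w)) (mX : forall i, measurableV (X i))
  (EX : centered P X) (fC : function_class c C Cn)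
  (hA1 : assumption_A1 (V := V) A1 A2) (hA2 : assumption_A2 P X c sigma2)
  (hA3 : assumption_A3 C Cn C1 C2) (PhiE : C_mixing_coef P X C Cn k = Phi%:E)
  (th0 : 0 <= th) (thc : th * c <= 1).

Let B := A1 ^+ 2 + A2.
(** By centering, the linear term leaves only its mixing error, of order [C1 * Phi];
    [sigma2 + C2 * Phi] bounds the second moment tested on past events. *)
Definition growth_factor :=
  1 + th * (A1 * C1 * Phi) + 2 * th ^+ 2 * (B * (sigma2 + C2 * Phi)).
Local Notation K := growth_factor.

Let mXb i : ball_measurable (X i).
Proof. exact: borel_ball_measurable. Qed.

Let Phi0 : 0 <= Phi.
Proof. exact: mixing_coef_ge0 mX cX fC PhiE. Qed.

Let B0 : 0 <= B.
Proof. by have [_ [A20 _]] := hA1; rewrite addr_ge0 ?sqr_ge0 ?ltW. Qed.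

Lemma growth_factor_ge1 : 1 <= K.
Proof.
have [A11 [A20 _]] := hA1; have [[C10 C20] _ _ _ _] := hA3.
have [_ s0 _ _] := hA2.
have A10 : 0 <= A1 by exact: le_trans A11.
rewrite /growth_factor -addrA lerDl addr_ge0//.
  by rewrite !mulr_ge0// ltW.
by rewrite !mulr_ge0 ?sqr_ge0// addr_ge0 ?mulr_ge0// ltW.
Qed.

Lemma second_moment_le i : \int[P]_w (`|X i w| ^+ 2) <= sigma2.
Proof.
have [_ _ _ /(_ i) h] := hA2; have [_ _ Csq _ _] := hA3.
have [_ iX] := function_class_comp P fC Csq (mX i) (cX i).
by rewrite -lee_fin fineK//; exact: integrable_fin_num.
Qed.

Lemma measurable_cosh_norm (Y : T -> V) : ball_measurable Y ->
  measurable_fun setT (fun w => coshR (th * `|Y w|)).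
Proof.
move=> /ball_measurable_norm mY; rewrite /coshR.
apply: measurable_funM => //; apply: measurable_funD; apply: measurableT_comp => //.
  exact: measurable_funM.
by apply: measurable_funN; exact: measurable_funM.
Qed.

Lemma cosh_norm_le (M : R) (v : V) : `|v| <= M ->
  coshR (th * `|v|) <= expR (th * M).
Proof.
move=> vM; have := @cosh_lipschitz R (th * `|v|) 0 (th * M).
by rewrite cosh0 mul1r; apply; rewrite subr0 normrM !ger0_norm// ler_wpM2l.
Qed.

Lemma integrable_cosh_norm (M : R) (Y : T -> V) : ball_measurable Y ->
  (forall w, `|Y w| <= M) ->
  P.-integrable setT (EFin \o (fun w => coshR (th * `|Y w|))).
Proof.
move=> mY YM; apply: (@bounded_integrable _ _ _ _ (expR (th * M))).
  exact: measurable_cosh_norm.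
by move=> w; rewrite gtr0_norm ?cosh_gt0// cosh_norm_le.
Qed.

(** A block starts from the empty sum, where the linear term of [cosh_norm_step] vanishes, so mixing
    does not enter. *)
Lemma mgf_first_le i :
  \int[P]_w coshR (th * `|X i w|) <= K.
Proof.
have [A11 [A20 _]] := hA1; have [[C10 C20] _ Csq _ _] := hA3.
have [s _ step] := cosh_norm_step hA1 0 th0 thc.
have [_ iX] := function_class_comp P fC Csq (mX i) (cX i).
have A10 : 0 <= A1 by exact: le_trans A11.
pose f w := 1 + 2 * B * th ^+ 2 * `|X i w| ^+ 2.
have icst := finite_measure_integrable_cst P 1 (measurableT : measurable [set: T]).
have iX2 : P.-integrable setT (EFin \o (fun w => 2 * B * th ^+ 2 * `|X i w| ^+ 2)).
  by have := integrableZl measurableT (2 * B * th ^+ 2) iX.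
have ifi : P.-integrable setT (EFin \o f) by have := integrableD measurableT icst iX2.
apply: (@le_trans _ _ (\int[P]_w f w)).
  apply: le_Rintegral => //.
    exact: (integrable_cosh_norm (mXb i) (cX i)).
  move=> w _; have := step _ (cX i w).
  by rewrite add0r normr0 mulr0 sinh0 mulr0 mul0r addr0 cosh0 mul1r.
have P1 : fine (P setT) = 1 by rewrite probability_setT.
rewrite RintegralD// RintegralZl// Rintegral_cst// [fine _]P1 mul1r.
rewrite /growth_factor -addrA lerD2l ler_wpDl//.
  by rewrite !mulr_ge0// ltW.
have -> : 2 * B * th ^+ 2 = 2 * th ^+ 2 * B by ring.
rewrite -mulrA ler_wpM2l ?mulr_ge0 ?sqr_ge0// ler_wpM2l//.
by rewrite (le_trans (second_moment_le i))// lerDl mulr_ge0.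
Qed.

(** With the past frozen at [v], the Taylor bound is a combination of a functional and the squared
    norm of the increment, and [mixing_bound] applies to each on [A]. *)
Lemma mgf_conditional_le (v : V) i A : (1 <= i)%N -> natural_filtration X i A ->
  \int[P]_(w in A) coshR (th * `|v + X (i + k)%N w|)
    <= K * coshR (th * `|v|) * fine (P A).
Proof.
move=> i1 FA; have mA := natural_filtration_measurable mX FA.
have [A11 [A20 _]] := hA1; have [[C10 C20] Cdual Csq CnC1 CnC2] := hA3.
have A10 : 0 <= A1 by exact: le_trans A11.
have [s s1 step] := cosh_norm_step hA1 v th0 thc.
set Y := X (i + k)%N.
have [_ iY] := function_class_comp P fC Csq (mX (i + k)) (cX (i + k)).
have [_ isY] := function_class_comp P fC (Cdual _ s1.1) (mX (i + k)) (cX (i + k)).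
pose a := coshR (th * `|v|); pose b := th * A1 * sinhR (th * `|v|).
have a0 : 0 <= a by rewrite ltW// cosh_gt0.
have b0 : 0 <= b.
  exact: mulr_ge0 (mulr_ge0 th0 A10) (sinh_ge0 (mulr_ge0 th0 (normr_ge0 v))).
pose f w := a + (a * (2 * B * th ^+ 2) * `|Y w| ^+ 2 + b * s (Y w)).
have iA (g : T -> R) : P.-integrable setT (EFin \o g) -> P.-integrable A (EFin \o g).
  by move=> /integrableS; apply.
have icst := finite_measure_integrable_cst P a mA.
have iY2 : P.-integrable A (EFin \o (fun w => a * (2 * B * th ^+ 2) * `|Y w| ^+ 2)).
  by have := integrableZl mA (a * (2 * B * th ^+ 2)) (iA _ iY).
have ibs : P.-integrable A (EFin \o (fun w => b * s (Y w))).
  by have := integrableZl mA b (iA _ isY).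
have iab : P.-integrable A (EFin \o (fun w => a * (2 * B * th ^+ 2) * `|Y w| ^+ 2 + b * s (Y w))).
  by have := integrableD mA iY2 ibs.
have ifi : P.-integrable A (EFin \o f) by have := integrableD mA icst iab.
have mvY : ball_measurable (fun w => v + Y w).
  move=> u e; have := mXb (i + k) (u - v) e; congr (measurable _).
  by apply/seteqP; split=> w /=; rewrite opprB addrCA addrA.
have p0 : 0 <= fine (P A) by rewrite fine_ge0.
apply: (@le_trans _ _ (\int[P]_(w in A) f w)).
  apply: le_Rintegral => //.
    apply: iA; apply: (@integrable_cosh_norm (`|v| + c)) => // w.
    by rewrite (le_trans (ler_normD _ _))// lerD2l; exact: cX.
  move=> w _; apply: le_trans (step _ (cX (i + k) w)) _.
  by rewrite le_eqVlt; apply/orP; left; apply/eqP; rewrite /f /a /b /B /Y; ring.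
rewrite RintegralD// RintegralD// RintegralZl ?iA// RintegralZl ?iA// Rintegral_cst//.
have h1 := mixing_bound mX cX fC PhiE Csq C20 CnC2 i1 FA.
have h2 := mixing_bound mX cX fC PhiE (Cdual _ s1.1) (ltW C10) (CnC1 _ s1) i1 FA.
move: h2; have -> : \int[P]_w s (X (i + k)%N w) = 0 by rewrite /Rintegral EX//; exact: s1.1.
rewrite add0r => h2.
have h3 : \int[P]_(w in A) `|Y w| ^+ 2 <= (sigma2 + C2 * Phi) * fine (P A).
  by rewrite (le_trans h1)// ler_wpM2r// lerD2r second_moment_le.
have q0 : 0 <= a * (2 * B * th ^+ 2) by rewrite !mulr_ge0 ?sqr_ge0.
apply: le_trans (lerD (lexx _) (lerD (ler_wpM2l q0 h3) (ler_wpM2l b0 h2))) _.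
(* [sinhR <= coshR] lets the linear error share the factor [a]. *)
have bb : b <= th * A1 * a by rewrite ler_wpM2l ?mulr_ge0// sinh_le_cosh.
have := ler_wpM2r (mulr_ge0 (mulr_ge0 (ltW C10) Phi0) p0) bb.
rewrite /growth_factor -/a; lra.
Qed.

Lemma mgf_step_le (M : R) (S : T -> V) (i : nat) : (1 <= i)%N ->
  (forall v a, natural_filtration X i [set w | `|S w - v| < a]) ->
  (forall w, `|S w| <= M) ->
  \int[P]_w coshR (th * `|S w + X (i + k)%N w|)
    <= K * \int[P]_w coshR (th * `|S w|).
Proof.
move=> i1 FS SM; set Y := X (i + k)%N.
have mS : ball_measurable S.
  by move=> v a; apply: natural_filtration_measurable (FS v a).
have mSY : ball_measurable (fun w => S w + Y w) by exact: ball_measurableD sepV mS (mXb _).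
have SYM w : `|S w + Y w| <= M + c.
  by rewrite (le_trans (ler_normD _ _))// lerD//; exact: cX.
have mvY v : ball_measurable (fun w => v + Y w).
  move=> u a; have := mXb (i + k) (u - v) a; congr (measurable _).
  by apply/seteqP; split=> w /=; rewrite opprB addrCA addrA.
have iS := integrable_cosh_norm mS SM.
have iSY := integrable_cosh_norm mSY SYM.
have K0 : 0 <= K.
  by rewrite (le_trans ler01)// growth_factor_ge1.
have [D dD] := dense_sequence sepV.
(* Each exchange of [S] with a nearby dense point costs [expR (th * e)], once before and once after
   the conditional bound; then [e] tends to [0]. *)
suff approx e : 0 < e -> \int[P]_w coshR (th * `|S w + Y w|)
    <= expR (th * e) ^+ 2 * (K * \int[P]_w coshR (th * `|S w|)).
  set a := (\int[P]_w coshR (th * `|S w + Y w|))%R in approx *.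
  set b := K * _ in approx *.
  have a0 : 0 <= a by apply: Rintegral_ge0 => w _; exact/ltW/cosh_gt0.
  apply/ler_addgt0Pr => e e0.
  have den0 : 0 < 2 * th * a + 1 by rewrite ltr_wpDl// !mulr_ge0.
  (* By [expR (- x) >= 1 - x] the loss is at most [2 * th * a * u], which this [u] keeps below
     [e]. *)
  pose u := e / (2 * th * a + 1).
  have u0 : 0 < u by rewrite divr_gt0.
  have : a * expR (- (2 * (th * u))) <= b.
    rewrite expRN ler_pdivrMr ?expR_gt0// mulrC.
    by have := approx u u0; rewrite -expRM_natl.
  rewrite -lerBlDr; apply: le_trans.
  apply: (@le_trans _ _ (a * (1 - 2 * (th * u)))); last first.
    by rewrite ler_wpM2l// expR_ge1Dx.
  rewrite mulrBr mulr1 lerD2l lerN2.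
  have -> : a * (2 * (th * u)) = (2 * th * a) * u by ring.
  have -> : e = (2 * th * a + 1) * u by rewrite /u mulrC divfK// gt_eqF.
  by rewrite ler_wpM2r ?(ltW u0)// lerDl.
move=> e0.
(* Making the preimages of the balls disjoint keeps them in the past; density makes them cover
   [T]. *)
pose F := seqDU (fun q => [set w | `|S w - D q| < e]).
have FF q : natural_filtration X i (F q).
  exact: (@seqDU_measurable _ (g_sigma_algebraType _) _ (fun q => FS (D q) e)).
have mF q : measurable (F q) by exact: natural_filtration_measurable (FF q).
have Fe q w : F q w -> `|S w - D q| < e by case.
have FT : \bigcup_q F q = setT.
  rewrite -seqDU_bigcup_eq; apply/seteqP; split=> // w _.
  by have [q] := dD (S w) e e0; exists q.
have iF q (g : T -> R) : P.-integrable setT (EFin \o g) -> P.-integrable (F q) (EFin \o g).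
  by move=> /integrableS; apply.
pose E := expR (th * e).
have piece q : \int[P]_(w in F q) coshR (th * `|S w + Y w|)
    <= E ^+ 2 * K * \int[P]_(w in F q) coshR (th * `|S w|).
  have iDY : P.-integrable setT (EFin \o (fun w => coshR (th * `|D q + Y w|))).
    apply: (@integrable_cosh_norm (`|D q| + c)) => // w.
    by rewrite (le_trans (ler_normD _ _))// lerD2l; exact: cX.
  apply: (@le_trans _ _ (\int[P]_(w in F q) (E * coshR (th * `|D q + Y w|)))).
    apply: le_Rintegral => //; first exact: iF.
      by have := integrableZl (mF q) E (iF q _ iDY).
    move=> w Fw; rewrite [leRHS]mulrC; apply: cosh_lipschitz.
    rewrite -mulrBr normrM ger0_norm//.
    rewrite ler_wpM2l// (le_trans (ler_dist_dist _ _))// opprD addrACA subrr addr0.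
    by rewrite ltW// (Fe q).
  rewrite RintegralZl ?iF//.
  apply: (@le_trans _ _ (E * (K * \int[P]_(w in F q) coshR (th * `|D q|)))).
    rewrite ler_wpM2l ?expR_ge0// Rintegral_cst// mulrA.
    exact: mgf_conditional_le.
  have -> : E ^+ 2 * K * \int[P]_(w in F q) coshR (th * `|S w|)
      = E * (K * (E * \int[P]_(w in F q) coshR (th * `|S w|))) by ring.
  rewrite ler_wpM2l ?expR_ge0// ler_wpM2l// -RintegralZl ?iF//.
  apply: le_Rintegral => //; first exact: finite_measure_integrable_cst.
    by have := integrableZl (mF q) E (iF q _ iS).
  move=> w Fw; rewrite [leRHS]mulrC; apply: cosh_lipschitz.
    rewrite -mulrBr normrM ger0_norm//.
  by rewrite ler_wpM2l// (le_trans (ler_dist_dist _ _))// distrC ltW// (Fe q).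
have cosh0E (x : R) : (0 <= (coshR x)%:E)%E by rewrite lee_fin ltW// cosh_gt0.
(* Nonnegativity allows summing the bounds [piece] over the countable partition. *)
have sumF (g : T -> R) : P.-integrable setT (EFin \o (fun w => coshR (g w))) ->
    (\int[P]_w (coshR (g w))%:E =
     \sum_(0 <= q <oo) \int[P]_(w in F q) (coshR (g w))%:E)%E.
  move=> /measurable_int mg; rewrite -FT ge0_integral_bigcup//.
    by rewrite FT.
  exact: trivIset_seqDU.
have E2K0 : 0 <= E ^+ 2 * K by rewrite mulr_ge0 ?sqr_ge0.
rewrite mulrA -lee_fin EFinM !fineK ?integrable_fin_num//.
rewrite !sumF//.
rewrite -nneseriesZl//; last by move=> q _; apply: integral_ge0 => w _; exact: cosh0E.
apply: lee_nneseries => [q _ _|q _].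
  by apply: integral_ge0 => w _; exact: cosh0E.
rewrite -[leLHS]fineK ?integrable_fin_num ?iF// -[X in (_ * X)%E]fineK ?integrable_fin_num ?iF//.
by rewrite -EFinM lee_fin piece.
Qed.

(** [ball_measurable_sum] is reused with [T] carrying the sigma-algebra of the past. *)
Lemma filtration_ball_sum (I : Type) (s : seq I) (idx : I -> nat) (i : nat) v a :
  (forall l, (1 <= idx l <= i)%N) ->
  natural_filtration X i [set w | `|\sum_(l <- s) X (idx l) w - v| < a].
Proof.
move=> idxi.
pose G := [set A | exists j B, [/\ (1 <= j <= i)%N, borelV B & A = X j @^-1` B]].
have mG l : ball_measurable (X (idx l) : g_sigma_algebraType G -> V).
  apply: borel_ball_measurable => D mD; apply: sub_sigma_algebra.
  by exists (idx l), D.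
exact: (ball_measurable_sum s sepV mG).
Qed.

Lemma norm_sum_le (I : Type) (s : seq I) (idx : I -> nat) w :
  `|\sum_(l <- s) X (idx l) w| <= \sum_(l <- s) c.
Proof.
by rewrite (le_trans (ler_norm_sum _ _ _))// ler_sum// => l _; exact: cX.
Qed.

Lemma block_mgf_le (b m : nat) :
  \int[P]_w coshR (th * `|\sum_(j < m.+1) X (b.+1 + j * k)%N w|) <= K ^+ m.+1.
Proof.
elim: m => [|m IHm].
  under eq_Rintegral do rewrite big_ord1 mul0n addn0.
  by rewrite expr1 mgf_first_le.
(* The new index is exactly [k] after [b.+1 + m * k], the last index of the partial sum. *)
under eq_Rintegral do rewrite big_ord_recr /= mulSn [(k + _)%N]addnC addnA.
apply: (le_trans (@mgf_step_le (\sum_(j < m.+1) c)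
  (fun w => \sum_(j < m.+1) X (b.+1 + j * k)%N w) (b.+1 + m * k)%N _ _ _)).
- by [].
- move=> v a; apply: (filtration_ball_sum _ (idx := fun j : 'I_m.+1 => (b.+1 + j * k)%N)) => j.
  by rewrite addSn ltnS leq0n /= ltnS leq_add2l leq_mul2r -ltnS ltn_ord orbT.
- by move=> w; exact: (norm_sum_le _ (fun j : 'I_m.+1 => (b.+1 + j * k)%N)).
by rewrite exprS ler_wpM2l// (le_trans ler01)// growth_factor_ge1.
Qed.

Lemma mean_tail_le (n l r : nat) (e : R) : (1 <= l)%N -> (r < k)%N ->
  n = (l * k + r)%N ->
  (P [set w | (e <= `|n%:R^-1 *: \sum_(1 <= i < n.+1) X i w|)%R]
    <= (2 * K ^+ l.+1 * expR (- (th * (n%:R / k%:R) * e)))%:E)%E.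
Proof.
move=> l1 rk nE; have k0 : (0 < k)%N by exact: leq_ltn_trans rk.
have k0R : 0 < k%:R :> R by rewrite ltr0n.
have n0 : (0 < n)%N by rewrite nE addn_gt0 muln_gt0 l1 k0.
have n0R : 0 < n%:R :> R by rewrite ltr0n.
set A := [set w | _ ].
have mA : measurable A.
  have mS : ball_measurable (fun w => \sum_(1 <= i < n.+1) X i w).
    exact: ball_measurable_sum.
  have mN := ball_measurable_norm mS.
  have -> : A = [set w | n%:R * e <= `|\sum_(1 <= i < n.+1) X i w|].
    apply/seteqP; split=> w; rewrite /A /=;
      by rewrite normrZ ger0_norm ?invr_ge0// ler_pdivlMl.
  rewrite -[X in measurable X]setTI.
  exact: measurable_fun_le (measurable_cst _) mN.
pose S (b : 'I_k) w := \sum_(j < l + (b < r)) X (b.+1 + j * k)%N w.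
pose f b w := coshR (th * `|S b w|).
have if_ b : P.-integrable setT (EFin \o f b).
  apply: (@integrable_cosh_norm (\sum_(j < l + (b < r)) c) (S b)).
    by apply: ball_measurable_sum => // j.
  by move=> w; exact: (norm_sum_le _ (fun j : 'I_(l + (b < r)) => (b.+1 + j * k)%N)).
have K1 : 1 <= K by exact: growth_factor_ge1.
(* Blocks have [l] or [l + 1] terms; [K >= 1] lets the larger power cover both. *)
have Ef b : \int[P]_w f b w <= K ^+ l.+1.
  have [m mE] : exists m, (l + (b < r))%N = m.+1.
    by exists (l + (b < r)).-1; rewrite prednK// addn_gt0 l1.
  rewrite /f /S mE; apply: le_trans (block_mgf_le b m) _.
  apply: ler_weXn2l => //; rewrite -mE.
  by case: (b < r)%N; rewrite ?addn1 ?addn0.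
rewrite -[P A]fineK ?fin_num_measure// lee_fin expRN ler_pdivlMr ?expR_gt0//.
(* Markov's inequality is applied to this average; its factor 2, from [expR x <= 2 * coshR x], is
   the one in the final bound. *)
pose g w := 2 * k%:R^-1 * \sum_(b < k) f b w.
have isum : P.-integrable setT (EFin \o (fun w => \sum_(b < k) f b w)).
  have := @integrable_sum _ _ _ P setT measurableT 'I_k (index_enum 'I_k) predT
    (fun b => EFin \o f b) (fun b _ => if_ b).
  by congr (integrable _ _); apply/funext => w; rewrite /= sumEFin.
have ig : P.-integrable setT (EFin \o g).
  by have := integrableZl measurableT (2 * k%:R^-1) isum.
have igA : P.-integrable A (EFin \o g) by move: ig => /integrableS; apply.
have g0 w : 0 <= g w.
  rewrite /g !mulr_ge0 ?invr_ge0// sumr_ge0// => b _.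
  by rewrite ltW// cosh_gt0.
apply: (@le_trans _ _ (\int[P]_(w in A) g w)).
  rewrite mulrC -Rintegral_cst//; apply: le_Rintegral => //.
    exact: finite_measure_integrable_cst.
  move=> w Aw.
  apply: (@le_trans _ _ (expR (k%:R^-1 * \sum_(b < k) th * `|S b w|))).
    rewrite ler_expR -mulr_sumr [leRHS]mulrCA.
    have -> : th * (n%:R / k%:R) * e = th * (k%:R^-1 * (n%:R * e)) by ring.
    rewrite ler_wpM2l// ler_wpM2l ?invr_ge0//.
    have : n%:R * e <= `|\sum_(1 <= i < n.+1) X i w|.
      by move: Aw; rewrite /A /= normrZ ger0_norm ?invr_ge0// ler_pdivlMl.
    move=> /le_trans; apply.
    rewrite {1}nE (sum_residues (fun i => X i w))//.
    exact: ler_norm_sum.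
  rewrite (le_trans (expR_mean_le _ k0))// /g -mulrA [leRHS]mulrCA ler_wpM2l ?invr_ge0//.
  by rewrite mulr_sumr ler_sum// => b _; exact: expR_le_cosh.
apply: (@le_trans _ _ (\int[P]_w g w)).
  rewrite /Rintegral fine_le ?integrable_fin_num//.
  apply: ge0_subset_integral => //; first exact: measurable_int ig.
  by move=> w _; rewrite lee_fin g0.
rewrite /g RintegralZl//.
have -> : \int[P]_w (\sum_(b < k) f b w) = \sum_(b < k) \int[P]_w f b w.
  rewrite /Rintegral; under eq_integral do rewrite -sumEFin.
  rewrite integral_sum// -sum_fine//.
  by move=> b _; apply: integrable_fin_num => //; exact: if_.
rewrite -mulrA ler_wpM2l// ler_pdivrMl//.
rewrite (le_trans (ler_sum _ (fun b _ => Ef b)))//.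
by rewrite sumr_const card_ord mulr_natl.
Qed.
End martingale_step.

(** * From exponential moments to the deviation inequality *)

Unset Implicit Arguments.

Theorem theorem3p1 (R : realType) (V : completeNormedModType R)
  (d : measure_display) (T : measurableType d) (P : probability T R)
  (X : nat -> T -> V) (c sigma2 A1 A2 C1 C2 : R)
  (C : set (V -> R)) (Cn : (V -> R) -> R) :
  separable_space (V := V) ->
  (forall i w, ballc c (X i w)) ->
  (forall i, measurableV (X i)) ->
  centered P X ->
  function_class c C Cn ->
  assumption_A1 (V := V) A1 A2 ->
  assumption_A2 P X c sigma2 ->
  assumption_A3 C Cn C1 C2 ->
  forall n l k r : nat, (1 <= n)%N -> (2 <= l)%N -> (0 < k)%N -> (r < k)%N ->
  n = (l * k + r)%N ->
  forall Phik : R, C_mixing_coef P X C Cn k = Phik%:E ->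
  forall nu : R, 0 < nu ->
  let B := A1 ^+ 2 + A2 in
  (P [set w : T | (4 * A1 * C1 * Phik
              + 4 * Num.sqrt (B * (sigma2 + C2 * Phik) * nu / l%:R)
              + 4 * c * nu / (3 * l%:R)
            <= `|n%:R^-1 *: \sum_(1 <= i < n.+1) X i w|)%R ]
   <= (2 * expR (- nu))%:E)%E.
Proof.
move=> sepV cX mX EX fC hA1 hA2 hA3 n l k r n1 l2 k0 rk nE Phi PhiE nu nu0; cbv zeta.
set B := A1 ^+ 2 + A2.
have Phi0 : 0 <= Phi := mixing_coef_ge0 mX cX fC PhiE.
have [A11 [A20 _]] := hA1; have [[C10 C20] _ _ _ _] := hA3.
have [c0 s0 _ _] := hA2.
pose a := A1 * C1 * Phi; pose v := B * (sigma2 + C2 * Phi).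
have a0 : 0 <= a by rewrite !mulr_ge0// ?(ltW C10)// (le_trans ler01).
have v0 : 0 < v.
  apply: mulr_gt0; first by rewrite ltr_wpDl ?sqr_ge0.
  by rewrite ltr_wpDr// mulr_ge0.
have L2 : 2 <= l%:R :> R by rewrite ler_nat.
have [th [th0 thc thE]] := bernstein_parameter L2 a0 v0 nu0 c0.
have -> : 4 * A1 * C1 * Phi = 4 * a by rewrite /a; ring.
rewrite -/v; set e := 4 * a + _ + _ in thE *.
have e0 : 0 <= e.
  apply: addr_ge0; first by apply: addr_ge0; rewrite mulr_ge0 ?sqrtr_ge0.
  by rewrite !(mulr_ge0, invr_ge0) ?(ltW c0) ?(ltW nu0).
have tail := mean_tail_le sepV cX mX EX fC hA1 hA2 hA3 PhiE th0 thc e (ltnW l2) rk nE.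
apply: (le_trans tail).
rewrite lee_fin -mulrA ler_wpM2l//.
have K0 : 0 <= growth_factor sigma2 A1 A2 C1 C2 Phi th.
  by rewrite (le_trans ler01)// (growth_factor_ge1 cX mX fC hA1 hA2 hA3 PhiE th0).
(* [1 + x <= expR x] turns the power of the growth factor into the exponent that [thE] controls. *)
have KE : growth_factor sigma2 A1 A2 C1 C2 Phi th <= expR (th * a + 2 * th ^+ 2 * v).
  by apply: le_trans (expR_ge1Dx _); rewrite addrA.
apply: (@le_trans _ _ (expR (th * a + 2 * th ^+ 2 * v) ^+ l.+1
    * expR (- (th * (n%:R / k%:R) * e)))).
  by rewrite ler_wpM2r ?expR_ge0// lerXn2r// nnegrE ?expR_ge0.
rewrite -expRM_natl -expRD ler_expR.
(* [n / k >= l], since the remainder [r] only enlarges [n]. *)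
have nk : th * l%:R * e <= th * (n%:R / k%:R) * e.
  rewrite ler_wpM2r// ler_wpM2l// ler_pdivlMr ?ltr0n//.
  by rewrite -natrM ler_nat nE leq_addr.
by rewrite -natr1; lra.
Qed.
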